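(* Suppose $p$ and $k$ are prime numbers. Then $\mathbb{F}_p^{\times} \leq (\mathbb{F}_{p^{km}}^{\times})^k$ for any positive integer $m$; that is, every nonzero element of the prime subfield $\mathbb{F}_p$ of $\mathbb{F}_{p^{km}}$ is a $k$-th power of an element of $\mathbb{F}_{p^{km}}^\times$.
   Context: For a finite field $\mathbb{F}_q$, $(\mathbb{F}_q^{\times})^k=\{\alpha\in\mathbb{F}_q^\times \mid \alpha=\beta^k \text{ for some } \beta\in\mathbb{F}_q^\times\}$ is the subgroup of nonzero $k$-th powers in the multiplicative group $\mathbb{F}_q^\times$. If $q$ is a power of the prime $p$, then $\mathbb{F}_p$ is regarded as the prime subfield of $\mathbb{F}_q$, and $\le$ denotes the subgroup relation inside $\mathbb{F}_q^\times$. *)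

(* Defs.v *)
From HB Require Import structures.
From mathcomp Require Import all_boot all_order all_algebra all_fingroup.
From mathcomp Require Import all_field.

Set Implicit Arguments.
Unset Strict Implicit.
Unset Printing Implicit Defensive.

Import GRing.Theory.
Local Open Scope ring_scope.

Section PrimeSubfield.
Variable F : finFieldType.

(* y = 0 needs no exclusion in the last clause, as x / 0 = 0 in F. *)
Definition is_subfield (K : {set F}) : bool :=
  [&& 1 \in K,
      [forall x in K, forall y in K, x - y \in K]
    & [forall x in K, forall y in K, x / y \in K]].

Lemma is_subfieldP (K : {set F}) :
  reflect (GRing.divring_closed [in K]) (is_subfield K).
Proof.
apply: (iffP and3P) => [[K1 /forall_inP KB /forall_inP KV]|[K1 KB KV]].
- split=> // x y Kx Ky; first exact: (forall_inP (KB x Kx)).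
  exact: (forall_inP (KV x Kx)).
- split=> //; apply/forall_inP=> x Kx; apply/forall_inP=> y Ky; first exact: KB.
  exact: KV.
Qed.

Definition prime_subfield : {set F} :=
  \bigcap_(K : {set F} | is_subfield K) K.

Lemma prime_subfield_is_subfield : is_subfield prime_subfield.
Proof.
apply/is_subfieldP; split=> [|x y /bigcapP Kx /bigcapP Ky|x y /bigcapP Kx /bigcapP Ky].
- by apply/bigcapP=> K /is_subfieldP[].
- by apply/bigcapP=> K sK; have /is_subfieldP[_ KB _] := sK; apply: KB; [apply: Kx|apply: Ky].
- by apply/bigcapP=> K sK; have /is_subfieldP[_ _ KV] := sK; apply: KV; [apply: Kx|apply: Ky].
Qed.

(* The prime subfield is the image of 'F_p under its unique embedding in F. *)
Lemma prime_subfieldE (p : nat) :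
  p \in [pchar F] -> prime_subfield = [set ((a : nat)%:R : F) | a : 'F_p].
Proof.
move=> chF; have p_pr := pcharf_prime chF.
have imP (x : F) : reflect (exists n : nat, x = n%:R)
                     (x \in [set ((a : nat)%:R : F) | a : 'F_p]).
  apply: (iffP imsetP) => [[a _ ->]|[n ->]]; first by exists a.
  exists (n%:R : 'F_p) => //; rewrite val_Fp_nat //.
  by rewrite [in LHS](divn_eq n p) natrD natrM (pcharf0 chF) mulr0 add0r.
apply/eqP; rewrite eqEsubset; apply/andP; split.
- apply: bigcap_inf; apply/is_subfieldP.
  have imM (x y : F) : (exists n : nat, x = n%:R) -> (exists n : nat, y = n%:R) ->
      exists n : nat, x * y = n%:R :> F.
    by move=> [n ->] [l ->]; exists (n * l)%N; rewrite natrM.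
  split=> [|x y /imP[n ->] /imP[l ->]|x y /imP Ix /imP Iy].
  + by apply/imP; exists 1%N.
  + apply/imP; exists (n + p.-1 * l)%N.
    rewrite natrD natrM -[in RHS]subn1 natrB ?prime_gt0 //.
    by rewrite (pcharf0 chF) sub0r mulN1r.
  + apply/imP/imM => //; have [l Ey] := Iy.
    have [->|y0] := eqVneq y 0; first by exists 0%N; rewrite invr0.
    exists (l ^ p.-2)%N; rewrite natrX -Ey.
    apply: (mulfI y0); rewrite divff // -exprS.
    have p2 : p.-2.+1 = p.-1 by case: (p) (prime_gt1 p_pr) => [|[|]].
    apply: (mulfI y0); rewrite p2 mulr1 -exprS prednK ?prime_gt0 //.
    by rewrite Ey -(pFrobenius_autE chF) pFrobenius_aut_nat.
- apply/subsetP=> x /imP[n ->]; have /is_subfieldP[P1 PB _] := prime_subfield_is_subfield.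
  have P0 : 0 \in prime_subfield by rewrite -(subrr (1 : F)); apply: PB.
  elim: n => [|n IHn] //; have -> : n.+1%:R = n%:R - (0 - 1) :> F.
    by rewrite sub0r opprK natr1.
  by apply: (PB) => //; apply: (PB).
Qed.

Definition prime_subfield_units : {set {unit F}} :=
  [set u | FinRing.uval u \in prime_subfield].

Lemma prime_subfield_units_group_set : group_set prime_subfield_units.
Proof.
have /is_subfieldP[P1 _ PV] := prime_subfield_is_subfield.
apply/group_setP; split=> [|u v]; rewrite !inE // => Pu Pv.
have -> : FinRing.uval (u * v)%g = FinRing.uval u / (1 / FinRing.uval v).
  by rewrite FinRing.val_unitM div1r invrK.
by apply: (PV) => //; apply: (PV).
Qed.

Canonical prime_subfield_units_group := Group prime_subfield_units_group_set.

Definition unit_powers (k : nat) : {set {unit F}} :=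
  [set a | [exists b : {unit F}, a == (b ^+ k)%g]].

Lemma unit_powers_group_set (k : nat) : group_set (unit_powers k).
Proof.
apply/group_setP; split=> [|u v]; rewrite !inE.
  by apply/existsP; exists 1%g; rewrite expg1n.
move=> /existsP[b /eqP->] /existsP[c /eqP->]; apply/existsP; exists (b * c)%g.
by rewrite expgMn //; apply/val_inj; rewrite /= mulrC.
Qed.

Canonical unit_powers_group (k : nat) := Group (unit_powers_group_set k).

End PrimeSubfield.

(* Main.v *)
Require Import Defs.
From mathcomp Require Import all_boot all_order all_algebra all_fingroup.
From mathcomp Require Import all_field.
From mathcomp Require Import cyclic.

Import GRing.Theory.

(** An element [u] of F_p^x has order dividing p - 1.  If k does not divide
    p - 1, then raising to the k-th power is bijective on the group generated
    by [u].  If k divides p - 1, then p = 1 modulo k, so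
    (p^k - 1)/(p - 1) = 1 + p + ... + p^(k-1) is divisible by k; hence k(p - 1)
    divides p^(km) - 1, the order of the cyclic group F^x, and in a cyclic group
    of such an order every element of order dividing p - 1 is a k-th power. *)

Lemma muln_pred_dvdn_pred_exp (p k : nat) :
  0 < p -> k %| p.-1 -> k * p.-1 %| (p ^ k).-1.
Proof.
move=> p_gt0 k_dvd; rewrite predn_exp mulnC dvdn_mul //.
have p1 : p = 1 %[mod k].
  by apply/eqP; rewrite eqn_mod_dvd // subn1.
rewrite /dvdn -modn_summ.
under eq_bigr => i _ do rewrite -modnXm p1 modnXm exp1n.
by rewrite modn_summ sum1_card card_ord modnn.
Qed.

Lemma expg_coprime_root (gT : finGroupType) (u : gT) (k n : nat) :
  coprime n k -> (u ^+ n = 1)%g -> exists v : gT, u = (v ^+ k)%g.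
Proof.
move=> co_nk /eqP; rewrite -order_dvdn => u_dvd.
(* [expg_invn <[u]> k] is an inverse of [k] modulo the order of [u]. *)
exists (u ^+ expg_invn <[u]> k)%g.
rewrite -expgM mulnC expgM expgK ?cycle_id //.
exact: coprime_dvdl u_dvd co_nk.
Qed.

(** For a generator [g] and [u = g ^+ i], the order of [g], hence [k * n], divides [i * n];
    cancelling [n] gives [k %| i]. *)
Lemma cyclic_expg_root (gT : finGroupType) (G : {group gT}) (u : gT)
    (k n : nat) :
  cyclic G -> 0 < n -> k * n %| #|G| -> u \in G -> (u ^+ n = 1)%g ->
  exists v : gT, u = (v ^+ k)%g.
Proof.
case/cyclicP=> g defG n_gt0; rewrite defG => kn_dvd /cycleP[i ->] /eqP.
rewrite -expgM -order_dvdn => /(dvdn_trans kn_dvd).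
rewrite dvdn_pmul2r // => /dvdnP[j ->].
by exists (g ^+ j)%g; rewrite expgM.
Qed.

Lemma prime_subfield_units_exp (F : finFieldType) (p : nat) (u : {unit F}) :
  p \in [pchar F]%R -> u \in prime_subfield_units F -> (u ^+ p.-1 = 1)%g.
Proof.
move=> chF; rewrite inE (prime_subfieldE chF) => /imsetP[a _ def_u].
(* Multiplying by [u] turns the goal into [u ^+ p = u]: Frobenius fixes the images of naturals. *)
apply: (mulgI u); rewrite mulg1 -expgS prednK ?prime_gt0 ?(pcharf_prime chF) //.
apply/val_inj; rewrite FinRing.val_unitX /= def_u.
by rewrite -(pFrobenius_autE chF) pFrobenius_aut_nat.
Qed.

Theorem theorem1p6 (p k : nat) (hp : prime p) (hk : prime k)
    (m : nat) (hm : 0 < m) (F : finFieldType) (hF : #|F| = p ^ (k * m)) :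
  prime_subfield_units_group F \subset unit_powers_group F k.
Proof.
have chF : p \in [pchar F]%R by apply: card_finPcharP hF hp.
apply/subsetP=> u Pu; have u1 := prime_subfield_units_exp _ _ _ chF Pu.
suff [v ->] : exists v, u = (v ^+ k)%g by rewrite inE; apply/existsP; exists v.
have [k_dvd | k_ndvd] := boolP (k %| p.-1); last first.
  by apply: expg_coprime_root u1; rewrite coprime_sym prime_coprime.
apply: (cyclic_expg_root _ [set: {unit F}]%G _ _ _ _ _ _ _ u1).
- exact: field_unit_group_cyclic.
- by rewrite -subn1 subn_gt0 prime_gt1.
- rewrite card_finField_unit hF expnM.
  (* It remains that [(p ^ k).-1] divides [((p ^ k) ^ m).-1], a geometric sum. *)
  apply: dvdn_trans (muln_pred_dvdn_pred_exp _ _ (prime_gt0 hp) k_dvd) _.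
  by rewrite [(_ ^ m).-1]predn_exp dvdn_mulr.
- by rewrite inE.
Qed.
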